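(* Let $X$ be a set endowed with a function $d: X\times X\to[0,+\infty)$ which satisfies the reverse triangle inequality and distinguishes points. Suppose that $X^+=\varnothing$ or $X^-=\varnothing$. Then the following statements are equivalent: 1. $(X,d)$ is a Lorentzian metric space; 2. there is a topology on $X$ such that $d$ is continuous (with respect to the product topology) and for each $p,q\in X$ the set $\overline{I(p,q)}$ is compact. Moreover, if $X$ admits a generating set $\mathscr{G}\subset X$, then either of the statements above is equivalent to the following: 3. there is a topology on $X$ such that $d$ is continuous (with respect to the product topology) and for each $p,q\in\mathscr{G}$ the set $\overline{I(p,q)}$ is compact.
   Context: Let $X$ be a set and $d:X\times X\to[0,+\infty)$ a function. Notation: $x\ll y$ iff $d(x,y)>0$; $I^+(x)=\{y: x\ll y\}$, $I^-(x)=\{y: y\ll x\}$; for $A\subset X$, $I^\pm(A)=\bigcup_{p\in A}I^\pm(p)$ and $I(A)=I^+(A)\cap I^-(A)$; $I(p,q):=I(\{p,q\})$. For $\epsilon>0$, $I_\epsilon=\{(x,y)\in X\times X: d(x,y)\ge\epsilon\}$. The reverse triangle inequality means $d(x,z)\ge d(x,y)+d(y,z)$ whenever $d(x,y)>0$ and $d(y,z)>0$. ''$d$ distinguishes points'' means that for all $x\ne y$ there is $z\in X$ with $d(x,z)\ne d(y,z)$ or $d(z,x)\ne d(z,y)$. $(X,d)$ is a Lorentzian metric space if: (i) $d$ satisfies the reverse triangle inequality; (ii) there is a topology $T$ on $X$ such that $d$ is continuous in the product topology and, for every $x,y\in X$ and $\epsilon>0$, the set $I_\epsilon\cap(\overline{I(x,y)}\times\overline{I(x,y)})$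 is compact (closure in $T$, compactness in the product topology); (iii) $d$ distinguishes points. $X^+=\{x\in X: d(x,y)=0\ \forall y\in X\}$ and $X^-=\{x\in X: d(y,x)=0\ \forall y\in X\}$. A subset $\mathscr{G}\subset X$ is a generating set if $X=I(\mathscr{G})$. In statements 2 and 3 closure and compactness refer to the topology in question. *)

(* Defs.v *)
From HB Require Import structures.
From mathcomp Require Import all_boot all_order all_algebra.
From mathcomp Require Import all_classical all_reals topology normedtype.

Set Implicit Arguments.
Unset Strict Implicit.
Unset Printing Implicit Defensive.

Import Order.TTheory GRing.Theory Num.Theory.
Import numFieldNormedType.Exports.

Local Open Scope classical_set_scope.
Local Open Scope ring_scope.

Section LorentzianDistance.
Context {R : realType} {X : Type}.
Variable d : X -> X -> R.

Definition reverse_triangle :=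
  forall x y z, 0 < d x y -> 0 < d y z -> d x y + d y z <= d x z.

Definition distinguishes_points :=
  forall x y, x <> y -> exists z, d x z <> d y z \/ d z x <> d z y.

Definition chron_future (x : X) : set X := [set y | 0 < d x y].

Definition chron_past (x : X) : set X := [set y | 0 < d y x].

Definition chron_diamond (A : set X) : set X :=
  (\bigcup_(p in A) chron_future p) `&` (\bigcup_(p in A) chron_past p).

(* The symmetric diamond I({p, q}) of a pair: neither point is designated as
   the past endpoint, and p = q is allowed. *)
Definition chron_diamond2 (p q : X) : set X := chron_diamond [set p; q].

Definition superlevel (e : R) : set (X * X) := [set xy | e <= d xy.1 xy.2].

Definition future_boundary : set X := [set x | forall y, d x y = 0].

Definition past_boundary : set X := [set x | forall y, d y x = 0].

Definition generating (G : set X) := chron_diamond G = setT.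

End LorentzianDistance.

(* A topology on the bare type X is an inhabitant of [Topological X], the class
   of topological structures with carrier X.  The eqType and choiceType
   components of that class exist classically on every type, so quantifying
   over it existentially amounts to quantifying over topologies. *)
Definition topologized (X : Type) (t : Topological X) : topologicalType :=
  Topological.Pack t.

Definition continuous_for (R : realType) (X : Type) (d : X -> X -> R)
    (t : Topological X) :=
  continuous (fun xy : topologized t * topologized t => d xy.1 xy.2).

Definition closed_diamond (R : realType) (X : Type) (d : X -> X -> R)
    (t : Topological X) (p q : X) : set (topologized t) :=
  closure (chron_diamond2 d p q : set (topologized t)).

Arguments continuous_for {R X} d t.
Arguments closed_diamond {R X} d t p q _.

Record lorentzian_metric_space (R : realType) (X : Type) (d : X -> X -> R)
    : Prop := LorentzianMetricSpace {
  lorentzian_ge0 : forall x y, 0 <= d x y;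
  lorentzian_reverse_triangle : reverse_triangle d;
  lorentzian_topology : exists t : Topological X,
    continuous_for d t /\
    forall (x y : X) (e : R), 0 < e ->
      compact ((superlevel d e : set (topologized t * topologized t)) `&`
               (closed_diamond d t x y `*` closed_diamond d t x y));
  lorentzian_distinguishes : distinguishes_points d
}.

Definition compact_diamonds_topology (R : realType) (X : Type)
    (d : X -> X -> R) (G : set X) :=
  exists t : Topological X,
    continuous_for d t /\
    forall p q : X, G p -> G q -> compact (closed_diamond d t p q).

(* Main.v *)
(* Suppose X^+ is empty and I(p, q) is nonempty with p << q.  Choose
   q << q1 << q2.  The distance from a point of I(p, q) to q1 is at least
   e := d(q, q1) > 0, which persists on the closure by continuity, and q1 lies
   in I(p, q2).  Hence the closure of I(p, q), times {q1}, lies in the compact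
   set I_e `&` (cl I(p, q2))^2, so cl I(p, q) is a closed subset of a projection
   of a compact set.  The case of X^- is dual.  For a generating set G, every
   nonempty I(p, q) is contained in some I(g, h) with g, h in G.  No step
   changes the topology. *)
Require Import Defs.
From HB Require Import structures.
From mathcomp Require Import all_boot all_order all_algebra.
From mathcomp Require Import all_classical all_reals topology normedtype.

Set Implicit Arguments.
Unset Strict Implicit.
Unset Printing Implicit Defensive.

Import Order.TTheory GRing.Theory Num.Theory.
Import numFieldNormedType.Exports.

Local Open Scope classical_set_scope.
Local Open Scope ring_scope.

Section ChronologicalDiamonds.
Context {R : realType} {X : Type}.
Variable d : X -> X -> R.
Hypothesis d_ge0 : forall x y, 0 <= d x y.
Hypothesis d_reverse : reverse_triangle d.

Lemma chron_trans x y z : 0 < d x y -> 0 < d y z -> 0 < d x z.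
Proof. by move=> xy yz; apply: lt_le_trans (d_reverse xy yz); rewrite addr_gt0. Qed.

(** The degenerate triangle x, x, x would give 2 d(x, x) <= d(x, x), impossible for a positive
    finite value. *)
Lemma chron_irrefl x : ~ 0 < d x x.
Proof. by move=> xx; have := d_reverse xx xx; rewrite gerDl leNgt xx. Qed.

Lemma chron_diamond2C p q : chron_diamond2 d p q = chron_diamond2 d q p.
Proof. by rewrite /chron_diamond2 setUC. Qed.

Lemma chron_diamond2_mem p q z :
  0 < d p z -> 0 < d z q -> chron_diamond2 d p q z.
Proof. by move=> pz zq; split; [exists p; [left|] | exists q; [right|]]. Qed.

(** The unions over the pair also allow p << z << p and q << z << q; irreflexivity excludes these
    cycles, leaving the two orientations. *)
Lemma chron_diamond2_cases p q z : chron_diamond2 d p q z ->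
  (0 < d p z /\ 0 < d z q) \/ (0 < d q z /\ 0 < d z p).
Proof.
case=> -[a + az] [b + zb]; rewrite /chron_future /chron_past /= in az zb *.
case=> ?; case=> ?; subst a b.
- by have /chron_irrefl := chron_trans az zb.
- by left.
- by right.
- by have /chron_irrefl := chron_trans az zb.
Qed.

Lemma chron_diamond2_inv p q z : 0 < d p q -> chron_diamond2 d p q z ->
  0 < d p z /\ 0 < d z q.
Proof.
move=> pq /chron_diamond2_cases[//|[qz zp]].
by have /chron_irrefl := chron_trans pq (chron_trans qz zp).
Qed.

(** The relation p << q fixes the orientation of the smaller diamond: a point with q << z << p would
    close a cycle. *)
Lemma chron_diamond2S p q p' q' : 0 < d p q ->
  (forall z, 0 < d p z -> 0 < d p' z) -> (forall z, 0 < d z q -> 0 < d z q') ->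
  chron_diamond2 d p q `<=` chron_diamond2 d p' q'.
Proof.
move=> pq pp' qq' z /(chron_diamond2_inv pq)[pz zq].
by apply: chron_diamond2_mem; [exact: pp'|exact: qq'].
Qed.

Section Topology.
Variable t : Topological X.
Local Notation T := (topologized t).

Lemma closed_diamond_closed p q : closed (closed_diamond d t p q).
Proof. exact: closed_closure. Qed.

Lemma closed_diamondS p q p' q' :
  chron_diamond2 d p q `<=` chron_diamond2 d p' q' ->
  closed_diamond d t p q `<=` closed_diamond d t p' q'.
Proof. exact: (@closureS T). Qed.

Lemma sub_closed_diamond p q (C : set T) : closed C ->
  chron_diamond2 d p q `<=` C -> closed_diamond d t p q `<=` C.
Proof. by move=> clC IC; rewrite [C](closure_id C).1//; exact: (@closureS T). Qed.

(** An empty diamond has empty closure, and any point of a nonempty one makes its endpoints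
    chronologically related in one of the two orders. *)
Lemma closed_diamond_compact_wlog p q :
  (0 < d p q -> compact (closed_diamond d t p q)) ->
  (0 < d q p -> compact (closed_diamond d t q p)) ->
  compact (closed_diamond d t p q).
Proof.
move=> cpq cqp; have [I0|/set0P[z Iz]] := eqVneq (chron_diamond2 d p q) set0.
  by rewrite /closed_diamond I0 closure0; exact: compact0.
have [[pz zq]|[qz zp]] := chron_diamond2_cases Iz.
  exact/cpq/(chron_trans pz zq).
by rewrite /closed_diamond chron_diamond2C; exact/cqp/(chron_trans qz zp).
Qed.

Hypothesis d_cont : continuous_for d t.

Lemma closed_superlevel e : closed (superlevel d e : set (T * T)).
Proof.
apply: (@preimage_closed _ _ (fun xy : T * T => d xy.1 xy.2) [set r | e <= r]).
  by move=> xy _; exact: d_cont.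
exact: closed_ge.
Qed.

Lemma closed_superlevel_left w e : closed ([set z | e <= d z w] : set T).
Proof.
apply: (@preimage_closed _ _ (fun z : T => (z, w : T)) (superlevel d e)).
  by move=> z _; apply: cvg_pair; [exact: cvg_id | exact: cvg_cst].
exact: closed_superlevel.
Qed.

Lemma closed_superlevel_right w e : closed ([set z | e <= d w z] : set T).
Proof.
apply: (@preimage_closed _ _ (fun z : T => (w : T, z)) (superlevel d e)).
  by move=> z _; apply: cvg_pair; [exact: cvg_cst | exact: cvg_id].
exact: closed_superlevel.
Qed.

Lemma continuous_fst : continuous (@fst T T).
Proof. by move=> z; exact: cvg_fst. Qed.

Lemma continuous_snd : continuous (@snd T T).
Proof. by move=> z; exact: cvg_snd. Qed.

(** The set is closed inside a product of two compact sets. Closedness comes from continuity of [d]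
    and from the diamonds being closures, so no Hausdorff property enters. *)
Lemma compact_superlevel_diamond x y e : compact (closed_diamond d t x y) ->
  compact ((superlevel d e : set (T * T)) `&`
           (closed_diamond d t x y `*` closed_diamond d t x y)).
Proof.
move=> cK; apply: (subclosed_compact _ (compact_setX cK cK)); last first.
  exact: subIsetr.
have clK := @closed_diamond_closed x y.
apply: closedI; [exact: closed_superlevel | apply: closedI].
  by apply: preimage_closed clK => z _; exact: continuous_fst.
by apply: preimage_closed clK => z _; exact: continuous_snd.
Qed.

Hypothesis d_compact : forall x y e, 0 < e ->
  compact ((superlevel d e : set (T * T)) `&`
           (closed_diamond d t x y `*` closed_diamond d t x y)).

Lemma compact_closed_diamond_future p q : future_boundary d = set0 ->
  0 < d p q -> compact (closed_diamond d t p q).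
Proof.
move=> d0 pq.
(* A point without successor has d(x, y) <= 0 for all y, hence lies in X^+ by nonnegativity. *)
have succ x : exists y, 0 < d x y.
  apply: contrapT => /forallNP dx0; suff : future_boundary d x by rewrite d0.
  by move=> y; apply/eqP; rewrite eq_le d_ge0 andbT leNgt; exact/negP/dx0.
have [q1 qq1] := succ q; have [q2 q12] := succ q1.
have cK := continuous_compact (continuous_subspaceT continuous_fst)
  (@d_compact p q2 _ qq1).
apply: subclosed_compact cK _ => [|z Iz]; first exact: closed_diamond_closed.
exists (z, q1) => //; split=> /=; last split=> /=.
(* On I(p, q), d(z, q1) >= d(z, q) + d(q, q1) >= d(q, q1). This bound is non-strict, so it defines a
   closed set and passes to the closure. *)
- apply: (sub_closed_diamond (@closed_superlevel_left q1 _)) Iz.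
  move=> {}z /(chron_diamond2_inv pq)[_ zq] /=.
  by apply: le_trans (d_reverse zq qq1); rewrite lerDr.
- apply: closed_diamondS Iz; apply: chron_diamond2S => // {}z zq.
  exact/(chron_trans zq)/(chron_trans qq1 q12).
- apply: subset_closure; apply: chron_diamond2_mem => //.
  exact: chron_trans qq1.
Qed.

(** Time dual: with p2 << p1 << p, the pairs (p1, z) satisfy d(p1, z) >= d(p1, p) and lie over the
    closure of I(p2, q); the second projection recovers z. *)
Lemma compact_closed_diamond_past p q : past_boundary d = set0 ->
  0 < d p q -> compact (closed_diamond d t p q).
Proof.
move=> d0 pq.
have pred x : exists y, 0 < d y x.
  apply: contrapT => /forallNP dx0; suff : past_boundary d x by rewrite d0.
  by move=> y; apply/eqP; rewrite eq_le d_ge0 andbT leNgt; exact/negP/dx0.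
have [p1 p1p] := pred p; have [p2 p21] := pred p1.
have cK := continuous_compact (continuous_subspaceT continuous_snd)
  (@d_compact p2 q _ p1p).
apply: subclosed_compact cK _ => [|z Iz]; first exact: closed_diamond_closed.
exists (p1, z) => //; split=> /=; last split=> /=.
- apply: (sub_closed_diamond (@closed_superlevel_right p1 _)) Iz.
  move=> {}z /(chron_diamond2_inv pq)[pz _] /=.
  by apply: le_trans (d_reverse p1p pz); rewrite lerDl.
- apply: subset_closure; apply: chron_diamond2_mem => //.
  exact: chron_trans pq.
- apply: closed_diamondS Iz; apply: chron_diamond2S => // {}z pz.
  exact/(chron_trans (chron_trans p21 p1p)).
Qed.

End Topology.

Lemma compact_diamonds_generating G : generating d G ->
  compact_diamonds_topology d G -> compact_diamonds_topology d setT.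
Proof.
move=> Gd [t [d_cont cG]]; exists t; split=> // p q _ _.
have cpq x y : 0 < d x y -> compact (closed_diamond d t x y).
  (* Only a generator g << x and a generator y << h are kept, so that x << z << y implies g << z <<
     h. *)
  move=> xy; have [] : chron_diamond d G x by rewrite Gd.
  move=> [g Gg gx] _; have [] : chron_diamond d G y by rewrite Gd.
  move=> _ [h Gh yh]; rewrite /chron_future /chron_past /= in gx yh.
  apply: (subclosed_compact _ (cG g h Gg Gh)).
    exact: closed_diamond_closed.
  apply: closed_diamondS; apply: chron_diamond2S => // z ?.
    exact: chron_trans gx _.
  exact: chron_trans yh.
by apply: closed_diamond_compact_wlog; exact: cpq.
Qed.

End ChronologicalDiamonds.

Theorem theorem2p14 (R : realType) (X : Type) (d : X -> X -> R)
  (d_ge0 : forall x y, 0 <= d x y)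
  (d_reverse : reverse_triangle d)
  (d_distinguishes : distinguishes_points d)
  (d_boundary : future_boundary d = set0 \/ past_boundary d = set0) :
  (lorentzian_metric_space d <-> compact_diamonds_topology d setT) /\
  (forall G : set X, generating d G ->
    (lorentzian_metric_space d <-> compact_diamonds_topology d G) /\
    (compact_diamonds_topology d setT <-> compact_diamonds_topology d G)).
Proof.
have lorentzP : lorentzian_metric_space d <-> compact_diamonds_topology d setT.
  split=> [[_ _ [t [d_cont d_compact]] _]|[t [d_cont cI]]].
    exists t; split=> // p q _ _.
    (* In each boundary case both orders of the pair p, q must be treated, since [p] and [q] are
       arbitrary. *)
    case: d_boundary => d0; apply: closed_diamond_compact_wlog => //.
    - exact: compact_closed_diamond_future.
    - exact: compact_closed_diamond_future.
    - exact: compact_closed_diamond_past.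
    - exact: compact_closed_diamond_past.
  split=> //; exists t; split=> // x y e _.
  by apply: compact_superlevel_diamond => //; exact: cI.
split=> // G Gd.
have genP : compact_diamonds_topology d setT <-> compact_diamonds_topology d G.
  split=> [[t [d_cont cI]]|]; last exact: compact_diamonds_generating.
  by exists t; split=> // p q _ _; exact: cI.
by split=> //; exact: iff_trans genP.
Qed.
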